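(* For fixed $n\ge 2$ there exists, for each $\epsilon>0$, a joint distribution of $X=(X_1,\dots,X_n)$ where $1\le X_1<X_2<\dots<X_n\le N(\epsilon)$ are all integers and $X$ has $\epsilon$-indistinguishable $(n-1)$-subsets, and $N(\epsilon)=\exp_2^{n-2}\left(\Theta\left(\frac1\epsilon\right)\right)$.
   Context: $\exp_2(x)=2^x$, and $\exp_2^{k}$ denotes its $k$-fold iterate (with $\exp_2^0(x)=x$). The notation $N(\epsilon)=\exp_2^{n-2}(\Theta(1/\epsilon))$ means that there are constants $c,C,\epsilon_0>0$, allowed to depend on $n$, such that $\exp_2^{n-2}(c/\epsilon)\le N(\epsilon)\le\exp_2^{n-2}(C/\epsilon)$ for all $\epsilon\in(0,\epsilon_0)$. The total variation distance between discrete random variables $A,B$ is $\delta(A,B)=\sum_x\max(\Pr(A=x)-\Pr(B=x),0)=\frac12\sum_x|\Pr(A=x)-\Pr(B=x)|$. $A$ and $B$ are $\epsilon$-indistinguishable if $\delta(A,B)\le\epsilon$. A tuple $(X_1,\dots,X_n)$ has $\epsilon$-indistinguishable $(n-1)$-subsets if for any two subsets $\{i_1,\dots,i_{n-1}\},\{j_1,\dots,j_{n-1}\}\subset\{1,\dots,n\}$ of size $n-1$, the random sets $\{X_{i_1},\dots,X_{i_{n-1}}\}$ and $\{X_{j_1},\dots,X_{j_{n-1}}\}$ are $\epsilon$-indistinguishable. *)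

(* Defs.v *)
From HB Require Import structures.
From mathcomp Require Import all_boot all_order all_algebra finmap.
From mathcomp Require Import all_classical all_reals all_analysis.
Set Implicit Arguments.
Unset Strict Implicit.
Unset Printing Implicit Defensive.
Import Order.TTheory GRing.Theory Num.Theory.
Local Open Scope classical_set_scope.
Local Open Scope ring_scope.

Definition exp2 (R : realType) (x : R) : R := 2 `^ x.

(* N(eps) = exp2^k(Theta(1/eps)) as eps tends to 0 from the right. *)
Definition iter_exp2_Theta (R : realType) (k : nat) (N : R -> R) : Prop :=
  exists c C eps0 : R, [/\ 0 < c, 0 < C, 0 < eps0 &
    forall eps : R, 0 < eps -> eps < eps0 ->
      iter k (@exp2 R) (c / eps) <= N eps <= iter k (@exp2 R) (C / eps)].

(* Used only for discrete A and B whose fibres are measurable. *)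
Definition tv_dist d (T : measurableType d) (R : realType)
    (P : probability T R) (V : choiceType) (A B : T -> V) : \bar R :=
  (\esum_(x in [set: V])
     maxe (P (A @^-1` [set x]) - P (B @^-1` [set x])) 0)%E.

Definition indistinguishable d (T : measurableType d) (R : realType)
    (P : probability T R) (V : choiceType) (eps : R) (A B : T -> V) : Prop :=
  (tv_dist P A B <= eps%:E)%E.

(* The values are unordered sets, so the indices in S are forgotten. *)
Definition random_subset d (T : measurableType d) (R : realType)
    (P : probability T R) (n : nat) (X : 'I_n -> {RV P >-> nat})
    (S : {set 'I_n}) (w : T) : {fset nat} :=
  [fset X i w | i in S]%fset.

Definition indistinguishable_subsets d (T : measurableType d) (R : realType)
    (P : probability T R) (n : nat) (X : 'I_n -> {RV P >-> nat}) (k : nat)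
    (eps : R) : Prop :=
  forall S S' : {set 'I_n}, #|S| = k -> #|S'| = k ->
    indistinguishable P eps (random_subset X S) (random_subset X S').

(* Main.v *)
(** Only an upper bound on the range is at stake, since N itself may be chosen.
    All distributions are uniform on a finite sample space, and two functions
    on it are close when a permutation of the space carries one to the other
    outside a small set of samples.

    For n = 2 take (U, U + 1), and for n = 3 the arithmetic progression
    U, U + 2^D, U + 2^(D+1), with U and D uniform: shifting D by one, or U by
    2^D, exchanges the pairs.  From n to n + 1, with n >= 3, let
    e_1 < ... < e_n <= N be a good tuple, put e_0 = 0, and take as new points
    the partial sums of independent gaps g_0, ..., g_n, where g_i is uniform on
    {1, ..., B^(N - e_i)} and B = 2^m.  Deleting an inner point merges the gaps
    g_i and g_(i+1); as the scale of g_(i+1) is smaller by a factor of at least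
    B, the sum is indistinguishable from g_i up to 1/B.  So deleting a point
    amounts to deleting one of the e_i, and the range grows from N to
    2^(2 m N), that is, by one exponential.  The step from 2 to 3 is done
    separately because there N = O(m), and 2^(2 m N) would be too large. *)
Require Import Defs.
From HB Require Import structures.
From mathcomp Require Import all_boot zify.
Set Implicit Arguments.
Unset Strict Implicit.
Unset Printing Implicit Defensive.

(** * Deletion of an entry, and couplings by permutations *)

Definition del (T : Type) (j : nat) (s : seq T) := take j s ++ drop j.+1 s.

Lemma del_cons (T : Type) j x (s : seq T) : del j.+1 (x :: s) = x :: del j s.
Proof. by []. Qed.

Lemma del_last (T : Type) (s : seq T) j : size s = j.+1 -> del j s = take j s.
Proof. by move=> sj; rewrite /del drop_oversize ?sj // cats0. Qed.

(* Under the uniform distribution on O, the laws of f and g are within a / m in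
   total variation. *)
Definition coupled (O : finType) (T : eqType) (a m : nat) (f g : O -> T) :=
  exists2 sigma : O -> O, injective sigma &
    #|[set w | f (sigma w) != g w]| * m <= a * #|O|.

Lemma eq_coupled (O : finType) (T : eqType) a m (f g f' g' : O -> T) :
  f =1 f' -> g =1 g' -> coupled a m f g -> coupled a m f' g'.
Proof.
move=> ff' gg' [sg injs le]; exists sg => //; apply: leq_trans le.
by rewrite leq_mul2r; apply/orP; right; apply: subset_leq_card;
   apply/subsetP => w; rewrite !inE ff' gg'.
Qed.

Lemma coupled_refl (O : finType) (T : eqType) a m (f : O -> T) : coupled a m f f.
Proof.
exists id => //; rewrite (_ : [set w | _] = set0) ?cards0 //.
by apply/setP => w; rewrite !inE eqxx.
Qed.

Lemma coupled_sym (O : finType) (T : eqType) a m (f g : O -> T) :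
  coupled a m f g -> coupled a m g f.
Proof.
move=> [sg injs le]; exists (invF injs); first exact: can_inj (f_invF injs).
apply: leq_trans le; rewrite leq_mul2r -(card_preimset _ injs).
apply/orP; right; apply: subset_leq_card; apply/subsetP => w.
by rewrite !inE invF_f eq_sym.
Qed.

Lemma coupled_trans (O : finType) (T : eqType) a b m (f g h : O -> T) :
  coupled a m f g -> coupled b m g h -> coupled (a + b) m f h.
Proof.
move=> [sg injs le1] [tau injt le2]; exists (sg \o tau); first exact: inj_comp.
rewrite mulnDl; apply: leq_trans (leq_add le1 le2).
rewrite -(card_preimset [set w | f (sg w) != g w] injt) -mulnDl leq_mul2r.
apply/orP; right; apply: leq_trans (leq_card_setU _ _); apply: subset_leq_card.
apply/subsetP => w; rewrite !inE /=; by case: (eqVneq (f _) (g _)) => //= ->.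
Qed.

Lemma coupled_comp (O : finType) (T T' : eqType) a m (f g : O -> T) (h : T -> T') :
  coupled a m f g -> coupled a m (h \o f) (h \o g).
Proof.
move=> [sg injs le]; exists sg => //; apply: leq_trans le.
rewrite leq_mul2r; apply/orP; right; apply: subset_leq_card.
by apply/subsetP => w; rewrite !inE; apply: contraNN => /= /eqP ->.
Qed.

(** The permutation leaves the independent factor [V] fixed, so the proportion of bad samples does
    not grow. *)
Lemma coupled_prod (O V : finType) (T T' : eqType) a m (f g : O -> T)
    (h : T -> V -> T') :
  coupled a m f g ->
  coupled a m (fun p : O * V => h (f p.1) p.2) (fun p => h (g p.1) p.2).
Proof.
move=> [sg injs le]; exists (fun p => (sg p.1, p.2)).
  by move=> [w v] [w' v'] /= [/injs -> ->].
rewrite card_prod mulnA; apply: leq_trans (leq_mul le (leqnn #|V|)).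
rewrite mulnAC leq_mul2r -cardsT -cardsX; apply/orP; right.
apply: subset_leq_card; apply/subsetP => -[w v]; rewrite !inE /= andbT.
by apply: contraNN => /eqP ->.
Qed.

(** * Cyclic shifts of one coordinate *)

Section Shift.
Variables (O I : finType) (M : nat).
Implicit Types (V : {ffun I -> 'I_M}).

Definition ord_add (x : 'I_M) (k : nat) : 'I_M :=
  Ordinal (ltn_pmod (x + k) (leq_ltn_trans (leq0n x) (ltn_ord x))).

Lemma ord_add_inj k : injective (ord_add^~ k).
Proof.
move=> x y /(congr1 val) /= /eqP; rewrite eqn_modDr !modn_small //.
by move/eqP/val_inj.
Qed.

Definition shift_at V (e : I) (k : nat) : {ffun I -> 'I_M} :=
  [ffun x => if x == e then ord_add (V x) k else V x].

(** The amount ignores the coordinate being shifted, so it can be computed from the image and the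
    shift undone. *)
Lemma shift_at_inj (e : O -> I) (k : O -> {ffun I -> 'I_M} -> nat) :
  (forall w V V', (forall i, i != e w -> V i = V' i) -> k w V = k w V') ->
  injective (fun p : O * {ffun I -> 'I_M} => (p.1, shift_at p.2 (e p.1) (k p.1 p.2))).
Proof.
move=> hk [w V] [w' V'] /= [<- /ffunP h].
have off i : i != e w -> V i = V' i.
  by move=> ie; have := h i; rewrite !ffunE (negPf ie).
congr (_, _); apply/ffunP => i; case: (eqVneq i (e w)) => [->|/off //].
by have := h (e w); rewrite !ffunE eqxx (hk _ _ _ off) => /ord_add_inj.
Qed.

(* Lowering the e w-th coordinate by c * (P w %/ B), for c < B, gives B pairwise
   disjoint translates of the set on the left. *)
Lemma card_wrap (e : O -> I) (P : O -> nat) (B : nat) :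
  (forall w, 0 < P w) -> (forall w, B %| P w) ->
  #|[set p : O * {ffun I -> 'I_M} | P p.1 <= P p.1 %/ B + p.2 (e p.1) %% P p.1]| * B
    <= #|{: O * {ffun I -> 'I_M}}|.
Proof.
move=> P0 BP; set bad := [set p | _].
have [->|B0] := posnP B; first by rewrite muln0.
pose sub (x : 'I_M) k : 'I_M := Ordinal (leq_ltn_trans (leq_subr k x) (ltn_ord x)).
pose F (q : (O * {ffun I -> 'I_M}) * 'I_B) : O * {ffun I -> 'I_M} :=
  (q.1.1, [ffun x => if x == e q.1.1 then sub (q.1.2 x) (q.2 * (P q.1.1 %/ B)) else q.1.2 x]).
have -> : #|bad| * B = #|setX bad [set: 'I_B]| by rewrite cardsX cardsT card_ord.
apply: (leq_card_in F).
move=> [[w V] c] [[w' V'] c']; rewrite !inE /= !andbT => b b' [ww' /ffunP h].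
subst w'.
have off i : i != e w -> V i = V' i.
  by move=> ie; have := h i; rewrite !ffunE (negPf ie).
have := h (e w); rewrite !ffunE eqxx => /(congr1 val) /=.
have [q Pq] : exists q, P w = q * B by exists (P w %/ B); rewrite divnK.
have q0 : 0 < q by move: (P0 w); rewrite Pq; case: (q).
move: b b'; rewrite Pq mulnK //.
move: (divn_eq (V (e w)) (q * B)) (divn_eq (V' (e w)) (q * B)).
have := ltn_pmod (V (e w)) (_ : 0 < q * B).
have := ltn_pmod (V' (e w)) (_ : 0 < q * B).
rewrite muln_gt0 q0 B0 => /(_ isT) r2B /(_ isT) r1B.
move: r2B r1B.
set r1 := V _ %% _; set r2 := V' _ %% _; set y1 := V _ %/ _; set y2 := V' _ %/ _.
move=> r2B r1B E1 E2 b1 b2 E.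
(* On [bad] the remainder modulo [q * B] is [B.-1 * q + t] with [t < q], so subtracting [c * q]
   never truncates. It leaves [(y * B + (B.-1 - c)) * q + t], and two divisions recover [y], [c] and
   [t]. *)
have hc : c = c' /\ V (e w) = V' (e w).
  have := ltn_ord c; have := ltn_ord c' => cB' cB.
  have euc A r A' r' d : r < d -> r' < d -> A * d + r = A' * d + r' -> A = A' /\ r = r'.
    move=> rd rd' AA; have d0 : 0 < d by apply: leq_ltn_trans rd.
    have := congr1 (divn^~ d) AA; rewrite /= !divnMDl // !divn_small // !addn0 => hA.
    by split=> //; move: AA; rewrite hA => /addnI.
  have digit r : q * B <= q + r -> r < q * B -> exists t, t < q /\ r = B.-1 * q + t.
    rewrite -{1 2}(prednK B0) mulnS mulnC leq_add2l => le lt.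
    by exists (r - B.-1 * q); split; [rewrite ltn_subLR // addnC|rewrite subnKC].
  have [t1 [t1q r1E]] := digit _ b1 r1B.
  have [t2 [t2q r2E]] := digit _ b2 r2B.
  have [d1 d1E] : exists d, B.-1 = c + d by exists (B.-1 - c); move: cB; clear; lia.
  have [d2 d2E] : exists d, B.-1 = c' + d by exists (B.-1 - c'); move: cB'; clear; lia.
  have [] := euc (y1 * B + d1) t1 (y2 * B + d2) t2 q t1q t2q.
    move: E; rewrite E1 E2 r1E r2E {1}d1E d2E !mulnDl.
    rewrite (mulnC q) !mulnA; move: (y1 * B * q) (y2 * B * q) => u u'.
    by clear; lia.
  move=> /euc[||yE dE tE].
  - by move: B0 d1E; clear; lia.
  - by move: B0 d2E; clear; lia.
  split; first by apply: val_inj => /=; move: d1E d2E dE; clear; lia.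
  by apply: val_inj; rewrite /= E1 E2 yE r1E r2E tE.
case: hc => -> hV; congr (_, _, _); apply/ffunP => i.
by case: (eqVneq i (e w)) => [->|/off].
Qed.

End Shift.

(** * Partial sums of gaps *)

Lemma eq_in_scanl (g g' : nat -> nat) a s : {in s, g =1 g'} ->
  scanl (fun x e => x + g e) a s = scanl (fun x e => x + g' e) a s.
Proof.
elim: s a => //= e s IH a h; rewrite h ?mem_head // IH // => x xs.
by rewrite h // inE xs orbT.
Qed.

Lemma take_scanl (g : nat -> nat) a j s :
  take j (scanl (fun x e => x + g e) a s) = scanl (fun x e => x + g e) a (take j s).
Proof. by elim: s j a => [|e s IH] [|j] a //=; rewrite IH. Qed.

(** The merged gap is charged to the entry at [j], and the entry at [j.+1] disappears; uniqueness
    keeps all other gaps as they were. *)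
Lemma del_scanl (g : nat -> nat) a j (t : seq nat) : uniq t -> j.+1 < size t ->
  del j (scanl (fun x e => x + g e) a t) =
  scanl (fun x e => x + (if e == nth 0 t j then g e + g (nth 0 t j.+1) else g e))
    a (del j.+1 t).
Proof.
elim: t j a => [|e [|f s] IH] [|j] a //=.
  rewrite inE negb_or => /andP[/andP[ef es] /andP[fs us]] _.
  rewrite /del /= !drop0 eqxx addnA; congr (_ :: _).
  apply: eq_in_scanl => x xs; case: eqVneq => // xe.
  by rewrite -xe xs in es.
move=> /andP[ei us] js; rewrite del_cons IH //=; case: (eqVneq e (nth 0 (f :: s) j)) => // ej.
by case/negP: ei; rewrite ej; apply: (mem_nth 0 (s := f :: s)); apply: ltnW js.
Qed.

Lemma scanl_sorted (g : nat -> nat) a s : (forall e, 0 < g e) ->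
  path ltn a (scanl (fun x e => x + g e) a s).
Proof. by move=> g0; elim: s a => //= e s IH a; rewrite IH andbT -addn1 leq_add2l. Qed.

Lemma scanl_le (g : nat -> nat) a s M : (forall e, g e <= M) ->
  all (fun x => x <= a + size s * M) (scanl (fun x e => x + g e) a s).
Proof.
move=> gM; elim: s a => //= e s IH a; apply/andP; split.
  by have := gM e; lia.
apply: sub_all (IH (a + g e)) => x /=; have := gM e; lia.
Qed.

(** * Good tuples: the base cases and the inductive step *)

Definition spread (n N a m : nat) (O : finType) (s : O -> seq nat) : Prop :=
  [/\ 0 < #|O|,
      forall w, [/\ size (s w) = n, path ltn 0 (s w) & all (fun x => x <= N) (s w)]
    & forall i j, i < n -> j < n ->
        coupled a m (fun w => del i (s w)) (fun w => del j (s w))].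

Lemma spread_le n N N' a m (O : finType) (s : O -> seq nat) :
  N <= N' -> spread n N a m s -> spread n N' a m s.
Proof.
move=> NN' [O0 hs hc]; split=> // w; have [sn ps /allP as_] := hs w; split=> //.
by apply/allP => x xs; apply: leq_trans NN'; apply: as_.
Qed.

Lemma spread2 m : 0 < m ->
  exists (O : finType) (s : O -> seq nat), spread 2 (2 * m) 2 m s.
Proof.
case: m => // m _; exists 'I_m.+1, (fun u : 'I_m.+1 => [:: u.+1; u.+2]).
(* Each deletion is compared with one reference law at cost 1 / m; two comparisons give the constant
   2. *)
have H i : i < 2 ->
    coupled 1 m.+1 (fun u : 'I_m.+1 => [:: u.+1]) (fun u => del i [:: u.+1; u.+2]).
  case: i => [|[|//]] _; last exact: coupled_refl.
  exists ((@ord_add m.+1)^~ 1); first exact: ord_add_inj.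
  rewrite card_ord leq_mul2r; apply/orP; right.
  apply: (@leq_trans #|[set @ord_max m]|); last by rewrite cards1.
  apply: subset_leq_card; apply/subsetP => u; rewrite !inE.
  apply: contraR => um; rewrite /= /del /= addn1 modn_small //.
  by have := ltn_ord u; rewrite ltnS leq_eqVlt -[_ == m]/(u == ord_max) (negPf um).
split; first by rewrite card_ord.
  by move=> u; split; rewrite /= ?ltnSn //; have := ltn_ord u; move: (nat_of_ord u); lia.
by move=> i j i2 j2; apply: (coupled_trans (coupled_sym (H i i2))) (H j j2).
Qed.

Lemma spread3 m : 0 < m ->
  exists (O : finType) (s : O -> seq nat), spread 3 (2 ^ (2 * m)) 2 m s.
Proof.
case: m => // m' _; set m := m'.+1.
(* A shift by [2 ^ d] with [d < m] is less than [2 ^ m], which is M / m, so it wraps around on at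
   most a fraction 1 / m of the samples. *)
pose M := m * 2 ^ m.
have M0 : 0 < M by rewrite muln_gt0 expn_gt0.
pose O : finType := ('I_m * {ffun 'I_1 -> 'I_M})%type.
pose s (p : O) :=
  let u := p.2 ord0 in [:: u.+1; u.+1 + 2 ^ p.1; u.+1 + 2 ^ p.1.+1].
pose h (p : O) :=
  let u := p.2 ord0 in [:: u.+1; u.+1 + 2 ^ p.1].
exists O, s.
have H i : i < 3 -> coupled 1 m h (fun p : O => del i (s p)).
  case: i => [|[|[|//]]] _; last exact: coupled_refl.
    exists (fun p : O => (p.1, shift_at p.2 ord0 (2 ^ p.1))).
      by apply: (shift_at_inj (e := fun=> ord0) (k := fun (d : 'I_m) _ => 2 ^ d)).
    have := @card_wrap 'I_m 'I_1 M (fun=> ord0) (fun=> M) m (fun=> M0).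
    rewrite mul1n => /(_ (fun=> dvdn_mulr _ (dvdnn m))); apply: leq_trans.
    rewrite leq_mul2r; apply/orP; right.
    apply: subset_leq_card; apply/subsetP => -[d V]; rewrite !inE /=.
    apply: contraR; rewrite -ltnNge mulKn // modn_small // => lt.
    rewrite /h /= ffunE eqxx /= modn_small; last first.
      by apply: leq_ltn_trans lt; rewrite addnC leq_add2r leq_pexp2l // ltnW.
    by rewrite /del /= expnS; apply/eqP; congr [:: _; _]; lia.
  exists (fun p : O => (ord_add p.1 1, p.2)).
    move=> [d V] [d' V'] /= e.
    by congr (_, _); [apply: ord_add_inj (congr1 fst e)|apply: (congr1 snd e)].
  rewrite mul1n; set bad := [set _ | _].
  have : #|bad| <= #|setX [set @ord_max m'] [set: {ffun 'I_1 -> 'I_M}]|.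
    apply: subset_leq_card; apply/subsetP => -[d V]; rewrite !inE /= andbT.
    apply: contraR => dm; rewrite /h /= addn1 modn_small //.
    by have := ltn_ord d; rewrite ltnS leq_eqVlt -[_ == m']/(d == ord_max) (negPf dm).
  rewrite cardsX cards1 mul1n cardsT card_prod card_ord mulnC => le.
  by rewrite leq_mul2l le orbT.
split.
- by rewrite card_prod card_ffun !card_ord muln_gt0 expn_gt0 M0.
- move=> [d V]; split=> //=.
    by rewrite -[X in X < _]addn0 !ltn_add2l expn_gt0 ltn_exp2l // ltnSn.
  have uM := ltn_ord (V ord0); have dm : 2 ^ d.+1 <= 2 ^ m by rewrite leq_exp2l.
  have dm' : 2 ^ d <= 2 ^ d.+1 by rewrite leq_exp2l.
  have : M + 2 ^ m <= 2 ^ (2 * m).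
    by rewrite mul2n -addnn expnD /M -mulSnr leq_mul2r ltn_expl ?orbT.
  move: (2 ^ (2 * m)) (2 ^ d.+1) (2 ^ d) (2 ^ m) dm dm' uM.
  by move: (nat_of_ord (V ord0)); clear=> u A B C D; lia.
by move=> i j i3 j3; apply: (coupled_trans (coupled_sym (H i i3))) (H j j3).
Qed.

Lemma ltn_seq_size N s : path ltn 0 s -> all (fun x => x <= N) s -> size s <= N.
Proof.
move=> ps as_; rewrite -[N](size_iota 1); apply: uniq_leq_size.
  by apply: (sorted_uniq ltn_trans ltnn); apply: path_sorted ps.
move=> x xs; rewrite mem_iota add1n ltnS (allP as_ _ xs) andbT.
by move: ps; rewrite (path_sortedE ltn_trans) => /andP[/allP/(_ _ xs)].
Qed.

Lemma spread_step n N a m : 0 < m -> 0 < n ->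
  (exists (O : finType) (s : O -> seq nat), spread n N a m s) ->
  exists (O : finType) (s : O -> seq nat), spread n.+1 (2 ^ (2 * m * N)) (a + 2) m s.
Proof.
move=> m0 n0 [O [s [O0 hs hc]]].
(* [M] is a multiple of every scale [P e], so a uniform coordinate has uniform residues modulo
   [P e]. *)
pose B := 2 ^ m; pose M := B ^ N.
have B0 : 0 < B by rewrite expn_gt0.
pose O' : finType := (O * {ffun 'I_N.+1 -> 'I_M})%type.
pose P e := B ^ (N - e).
(* Gaps are indexed by the value [e], not by its position. Hence [F] depends only on the list and on
   independent randomness, and couplings of lists pass to [F]. *)
pose g (V : {ffun 'I_N.+1 -> 'I_M}) e := (V (inord e) %% P e).+1.
pose F (t : seq nat) V := scanl (fun x e => x + g V e) 0 (0 :: t).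
have P0 e : 0 < P e by rewrite expn_gt0 B0.
have gP V e : g V e <= P e by rewrite ltn_pmod.
have PM e : P e <= M by rewrite leq_pexp2l // leq_subr.
have H i : i < n.+1 -> exists2 j, j < n &
    coupled 1 m (fun p : O' => F (del j (s p.1)) p.2) (fun p : O' => del i (F (s p.1) p.2)).
  rewrite ltnS leq_eqVlt => /orP[/eqP -> {i}|ltin].
    (* Deleting the last point drops the last gap, with no loss. *)
    exists n.-1; first by rewrite prednK.
    apply: eq_coupled (coupled_refl _ _ _) => [p //|p] /=.
    have [sn _ _] := hs p.1.
    rewrite (@del_last _ (s p.1)) ?prednK // (@del_last _ (F _ _)) ?size_scanl /= ?sn //.
    by rewrite /F take_scanl; congr scanl; case: (n) n0.
  (* Deleting the i-th partial sum merges the gaps of scales e and f; shifting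
     the e-th coordinate by the gap at f reproduces the merged gap. *)
  exists i => //.
  pose e (w : O) : nat := nth 0 (0 :: s w) i.
  pose f (w : O) : nat := nth 0 (s w) i.
  have ef w : e w < f w.
    have [sn ps _] := hs w.
    by apply: (pathP 0 ps); rewrite sn.
  have fN w : f w <= N.
    have [sn _ as_] := hs w.
    by apply: (allP as_); rewrite mem_nth // sn.
  exists (fun p : O' => (p.1, shift_at p.2 (inord (e p.1)) (g p.2 (f p.1)))).
    apply: (shift_at_inj (e := fun w => inord (e w)) (k := fun w V => g V (f w))).
    move=> w V V' VV'; rewrite /g VV' //.
    apply/eqP => /(congr1 val); rewrite /= !inordK ?ltnS //.
      by move: (ef w) => /[swap] ->; rewrite ltnn.
    by apply: leq_trans (fN w); apply: ltnW.
  (* The shift is at most [P (f w)], hence at most [P (e w) %/ B]: only on [wrap] can it carry the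
     residue past [P (e w)]. This is a fraction at most 1 / B, below 1 / m. *)
  rewrite mul1n; pose wrap : {set O'} :=
    [set p : O' | P (e p.1) <= P (e p.1) %/ B + p.2 (inord (e p.1)) %% P (e p.1)].
  apply: (@leq_trans (#|wrap| * B)); last first.
    apply: (@card_wrap O 'I_N.+1 M (fun w => inord (e w)) (fun w => P (e w))) => // w.
    by rewrite /P dvdn_exp // subn_gt0; apply: leq_trans (fN w).
  apply: leq_mul; last by apply: ltnW; apply: ltn_expl.
  apply: subset_leq_card; apply/subsetP => -[w V]; rewrite !inE /=.
  apply: contraR; rewrite -ltnNge => lt.
  have [sn ps as_] := hs w.
  rewrite /F -(del_cons i 0) del_scanl; last 2 first.
  - by apply: (sorted_uniq ltn_trans ltnn (s := 0 :: s w)).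
  - by rewrite /= sn.
  apply/eqP; apply: eq_in_scanl => x xs.
  have xN : x <= N.
    have : x \in 0 :: s w by move: xs; rewrite mem_cat => /orP[/mem_take|/mem_drop].
    by rewrite inE => /orP[/eqP -> //|]; apply: (allP as_).
  have eN : e w <= N by apply: ltnW; apply: leq_trans (fN w).
  rewrite -/(e w) -[nth 0 (0 :: s w) i.+1]/(f w) /g ffunE.
  rewrite -(inj_eq val_inj) /= !inordK //; case: eqVneq => // ->.
  (* As [P (e w)] divides [M], wrapping modulo [M] is invisible here. *)
  rewrite /= modn_dvdm; last by rewrite dvdn_exp2l // leq_subr.
  rewrite -modnDml modn_small ?addSn //.
  apply: leq_ltn_trans lt; rewrite addnC leq_add2r leq_divRL //.
  apply: leq_trans (leq_mul (gP V (f w)) (leqnn B)) _.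
  rewrite /P -expnSr leq_pexp2l //.
  by have := ef w; have := fN w; lia.
exists O', (fun p : O' => F (s p.1) p.2); split.
- by rewrite card_prod card_ffun !card_ord muln_gt0 O0 !expn_gt0.
- move=> [w V]; have [sn ps as_] := hs w; split.
  + by rewrite size_scanl /= sn.
  + exact: scanl_sorted.
  have /allP le := scanl_le 0 (0 :: s w) (fun e => leq_trans (gP V e) (PM e)).
  apply/allP => x /le /leq_trans; apply; rewrite add0n /= -mulnA mul2n -addnn expnD.
  rewrite /M /B -expnM leq_mul2r; apply/orP; right.
  (* The number of gaps is at most [N + 1], hence at most [2 ^ (m * N)], the second factor of the
     range. *)
  apply: leq_ltn_trans (ltn_seq_size ps as_) _; apply: leq_ltn_trans (_ : m * N < _).
    exact: leq_pmull.
  exact: ltn_expl.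
move=> i j /H[i' i'n Hi] /H[j' j'n Hj].
have Hij := coupled_prod (V := {ffun 'I_N.+1 -> 'I_M}) F (hc _ _ i'n j'n).
have := coupled_trans (coupled_trans (coupled_sym Hi) Hij) Hj.
by rewrite -addnA addnCA.
Qed.

(** * Growth of the range *)

Definition tower (k x : nat) : nat := iter k (expn 2) x.

Lemma towerD k x m : tower k x + m <= tower k (x + m).
Proof.
elim: k => //= k IH; apply: leq_trans (_ : _ <= 2 ^ (tower k x + m)) _; last first.
  by rewrite leq_exp2l.
elim: m {IH} => [|m IHm]; first by rewrite !addn0.
by rewrite !addnS expnS mul2n -addnn -addn1 leq_add ?expn_gt0.
Qed.

(** As [2 * m <= 2 ^ m], the factor is absorbed by adding [m] to the argument. This takes at least
    one exponential, so the induction starts at three points. *)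
Lemma tower_mul k x m : 0 < m -> 2 * m * tower k.+1 x <= tower k.+1 (x + m).
Proof.
move=> m0 /=; apply: leq_trans (_ : _ <= 2 ^ (tower k x + m)) _; last first.
  by rewrite leq_exp2l // towerD.
rewrite expnD mulnC leq_mul2l; apply/orP; right.
by case: m m0 => // m _; rewrite expnS leq_mul2l /= ltn_expl.
Qed.

Lemma spread_tower k : exists a c, [/\ 0 < a, 0 < c &
  forall m, 0 < m -> exists (O : finType) (s : O -> seq nat),
    spread k.+2 (tower k (c * m)) a m s].
Proof.
elim: k => [|[|k] IH].
- by exists 2, 2; split=> // m /spread2.
- by exists 2, 2; split=> // m /spread3.
have [a [c [a0 c0 H]]] := IH.
exists (a + 2), c.+1; split=> //; first by rewrite addn2.
move=> m m0; have [//|O [s hs]] := spread_step m0 _ (H m m0).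
exists O, s; apply: spread_le hs.
by rewrite [leqRHS]/= leq_exp2l // (mulSnr c); exact: tower_mul.
Qed.

From mathcomp Require Import all_order all_algebra finmap.
From mathcomp Require Import all_classical all_reals all_analysis.
Import Order.TTheory GRing.Theory Num.Theory.
Local Open Scope classical_set_scope.
Local Open Scope ring_scope.

(** * From couplings to total variation distance *)

Section Uniform.
Variable R : realType.

Definition count_below (K : nat) : {measure set nat -> \bar R} :=
  msum (fun k => \d_k) K.

Lemma count_belowE K A :
  count_below K A = (\sum_(k < K) (val k \in A)%:R)%:E :> \bar R.
Proof. by rewrite /= /msum -sumEFin; apply: eq_bigr => k _; rewrite /= diracE. Qed.

(** Living on [nat], where every set is measurable; the Dirac mass is only the default for
    [K = 0]. *)
Definition uniform_nat (K : nat) : probability nat R :=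
  mnormalize (count_below K) \d_0%N.

Lemma uniform_natE K A : (0 < K)%N ->
  uniform_nat K A = ((\sum_(k < K) (val k \in A)%:R) / K%:R)%:E :> \bar R.
Proof.
move=> K0; rewrite -[LHS]/(mnormalize (count_below K) \d_0%N A) /mnormalize count_belowE.
have -> : (\sum_(k < K) (val k \in [set: nat])%:R = K%:R :> R).
  by under eq_bigr do rewrite in_setT; rewrite sumr_const card_ord.
by rewrite eqe pnatr_eq0 gtn_eqF //= count_belowE EFinM.
Qed.

Variables (O : finType) (o0 : O).

(** Samples beyond [#|O|] default to [o0], so bounds on [O] hold at every sample, not just almost
    surely. *)
Definition draw (k : nat) : O := nth o0 (enum O) k.

Lemma uniform_draw (V : eqType) (f : O -> V) (x : V) :
  uniform_nat #|O| ((f \o draw) @^-1` [set x]) =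
  ((\sum_o (f o == x)%:R) / #|O|%:R)%:E :> \bar R.
Proof.
rewrite uniform_natE; last by apply/card_gt0P; exists o0.
congr ((_ / _)%:E).
rewrite [RHS](reindex (@enum_val O O)) /=; last exact: onW_bij (enum_val_bij O).
apply: eq_bigr => k _.
rewrite (enum_val_nth o0) -/(draw k); congr (nat_of_bool _)%:R.
by apply/idP/eqP; rewrite inE.
Qed.

(** After reindexing by [sg], only bad samples contribute to the difference at [x], by at most the
    mass [b x]. Each bad sample counts for one [x] only, so these masses sum to at most a / m. *)
Lemma coupled_indistinguishable (V : choiceType) a m (eps : R) (f g : O -> V) :
  (0 < m)%N -> a%:R / m%:R <= eps -> coupled a m f g ->
  indistinguishable (uniform_nat #|O|) eps (f \o draw) (g \o draw).
Proof.
move=> m0 ame [sg injs le]; rewrite /indistinguishable /tv_dist.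
have O0 : 0 < #|O|%:R :> R by rewrite ltr0n; apply/card_gt0P; exists o0.
pose b x : R := (\sum_(o in [set w | f (sg w) != g w]%SET) (f (sg o) == x)%:R) / #|O|%:R.
apply: ge_ereal_sup => _ [A [finA _] <-].
rewrite fsbig_finite //.
apply: (@le_trans _ _ (\sum_(x <- fset_set A) (b x)%:E)%E).
  apply: lee_sum => x _; rewrite ge_max !uniform_draw -EFinB !lee_fin; apply/andP; split.
    rewrite -mulrBl ler_pM2r ?invr_gt0 // (reindex_inj injs) -sumrB.
    rewrite [leRHS]big_mkcond; apply: ler_sum => o _; rewrite inE.
    case: (eqVneq (f (sg o)) (g o)) => [->|_] /=; first by rewrite subrr.
    by rewrite lerBlDr lerDl.
  by rewrite divr_ge0 // sumr_ge0.
rewrite sumEFin lee_fin; apply: le_trans ame.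
rewrite -mulr_suml ler_pdivrMr // mulrAC ler_pdivlMr ?ltr0n //.
rewrite exchange_big /=.
apply: (@le_trans _ _ (#|[set w | f (sg w) != g w]%SET|%:R * m%:R)); last first.
  by rewrite -!natrM ler_nat.
rewrite ler_wpM2r // -sum1_card natr_sum; apply: ler_sum => o _.
rewrite -natr_sum ler_nat.
rewrite -big_mkcond /= sum1_count.
by rewrite (eq_count (a2 := pred1 (f (sg o)))) ?count_uniq_mem ?leq_b1.
Qed.

End Uniform.

(** * Real exponentials, index sets and the conclusion *)

Lemma iter_exp2_nat (R : realType) k x :
  iter k (@exp2 R) x%:R = (tower k x)%:R.
Proof. by elim: k => //= k ->; rewrite /exp2 powR_mulrn // natrX. Qed.

Lemma le_iter_exp2 (R : realType) k (x y : R) :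
  x <= y -> iter k (@exp2 R) x <= iter k (@exp2 R) y.
Proof. by move=> xy; elim: k => //= k IH; rewrite /exp2 ler_powR // ler1n. Qed.

Lemma fset_del n (t : seq nat) (j : 'I_n) : size t = n ->
  [fset nth 0%N t (val i) | i in [set~ j]%SET]%fset = [fset x in del j t]%fset.
Proof.
move=> tn; apply/fsetP => x; rewrite !inE; apply/imfsetP/idP => [[i /= ij ->]|].
  rewrite !inE /= in ij.
  case: (ltngtP i j) => [lt|lt|/val_inj eij].
  - by rewrite -(nth_take 0%N lt) mem_nth // size_take tn ltn_ord lt.
  - rewrite -(subnKC lt) -nth_drop mem_nth ?orbT // size_drop tn.
    by rewrite ltn_sub2r // (leq_ltn_trans lt).
  - by rewrite eij eqxx in ij.
move=> /orP[] /(nthP 0%N) [i].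
  rewrite size_take tn ltn_ord => ij <-.
  exists (Ordinal (ltn_trans ij (ltn_ord j))); last by rewrite nth_take.
  by rewrite !inE -(inj_eq val_inj) /= ltn_eqF.
rewrite size_drop tn ltn_subRL => ij <-; exists (Ordinal ij); last by rewrite nth_drop.
by rewrite !inE -(inj_eq val_inj) /= gtn_eqF // ltnS leq_addr.
Qed.

Lemma set_card_pred n (S : {set 'I_n}) : (0 < n)%N -> #|S| = (n - 1)%N ->
  exists j, S = [set~ j]%SET.
Proof.
move=> n0 cS; have /eqP/cards1P[j Sj] : #|~: S| = 1%N.
  by rewrite cardsCs finset.setCK cS card_ord subKn.
by exists j; rewrite -Sj finset.setCK.
Qed.

(** An alias to carry the measurability instance that makes any such function a random variable. *)
Definition natfun (f : nat -> nat) : nat -> nat := f.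

Lemma measurable_natfun f : measurable_fun setT (natfun f).
Proof. by []. Qed.

HB.instance Definition _ f :=
  isMeasurableFun.Build _ _ _ _ (natfun f) (measurable_natfun f).

Theorem corollary27 (R : realType) (n : nat) (hn : (2 <= n)%N) :
  exists N : R -> R,
    iter_exp2_Theta (n - 2) N /\
    forall eps : R, 0 < eps ->
      exists (d : measure_display) (T : measurableType d)
        (P : probability T R) (X : 'I_n -> {RV P >-> nat}),
        [/\ forall (i : 'I_n) (w : T), (1 <= X i w)%N /\ (X i w)%:R <= N eps,
            forall (i j : 'I_n) (w : T), (i < j)%N -> (X i w < X j w)%N
          & indistinguishable_subsets X (n - 1) eps].
Proof.
case: n hn => [|[|k]] // _; rewrite subn2 /=.
have [a [c [a0 c0 H]]] := spread_tower k.
pose m (eps : R) := (Num.truncn (a%:R / eps)).+1.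
exists (fun eps => (tower k (c * m eps))%:R); split.
  (* For [eps < 1], a / eps < m <= a / eps + 1 <= (a + 1) / eps. *)
  exists (c * a)%:R, (c * a.+1)%:R, 1; split=> //; rewrite ?ltr0n ?muln_gt0 ?a0 ?c0 //.
  move=> eps eps0 eps1; rewrite -iter_exp2_nat.
  apply/andP; split; apply: le_iter_exp2; rewrite !natrM -mulrA ler_wpM2l //.
    exact/ltW/truncnS_gt.
  rewrite /m -[X in X%:R <= _]addn1 -[a.+1]addn1 !natrD mulrDl lerD //.
    by rewrite truncn_le divr_ge0 // ltW.
  by rewrite mul1r -[leLHS]invr1 lef_pV2 ?posrE // ltW.
move=> eps eps0; have [U [s [U0 hs hc]]] := H (m eps) (ltn0Sn _).
have /card_gt0P[u0 _] := U0.
pose X (i : 'I_k.+2) : {RV (uniform_nat R #|U|) >-> nat} :=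
  natfun (fun w => nth 0%N (s (draw u0 w)) i).
exists _, _, (uniform_nat R #|U|), X; split.
- move=> i w; have [sn ps as_] := hs (draw u0 w).
  have Xs : X i w \in s (draw u0 w) by rewrite /X /natfun mem_nth // sn.
  split; last by rewrite ler_nat; apply: (allP as_).
  by move: ps; rewrite (path_sortedE ltn_trans) => /andP[/allP/(_ _ Xs)].
- move=> i j w ij; have [sn ps _] := hs (draw u0 w).
  have so := path_sorted ps.
  by rewrite /X /= /natfun (sorted_ltn_nth ltn_trans 0%N so) // inE sn.
move=> S S' /set_card_pred [//|j ->] /set_card_pred [//|j' ->].
have E i : random_subset X [set~ i]%SET =
    (fun t => [fset x in t]%fset) \o (fun u => del i (s u)) \o draw u0.
  by apply/funext => w; have [sn _ _] := hs (draw u0 w); apply: fset_del.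
rewrite !E; apply: (@coupled_indistinguishable R U u0 _ a (m eps)) => //.
  by rewrite ler_pdivrMr ?ltr0n // mulrC -ler_pdivrMr //; apply/ltW/truncnS_gt.
by apply: coupled_comp; apply: hc.
Qed.
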